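(* Let $f\colon\mathbb{R}^n\to\mathbb{R}$ be a differentiable function and let $\bm{w}^\star\in\arg\min_{\bm{w}\in\mathbb{R}^n}f(\bm{w})$ be a minimizer of $f$. Suppose that $f$ is $\Gamma$-weakly smooth and $(\rho,\mu)$-strongly quasar-convex with respect to $\bm{w}^\star$. Consider any $\bm{w}\in\mathbb{R}^n$ and $\bm{w}^+=\bm{w}-\alpha\nabla f(\bm{w})$ with step size $$0<\alpha<\min\left(\frac{2\rho}{\Gamma},\ \frac{2\Gamma+\rho^2\mu-\sqrt{4\Gamma\rho^2\mu+\rho^4\mu^2}}{\Gamma\rho\mu}\right).$$ Then $$\|\bm{w}^+-\bm{w}^\star\|^2\le\gamma\|\bm{w}-\bm{w}^\star\|^2,\qquad \gamma=1-\alpha\rho\mu-\frac{(2\alpha\rho-\alpha^2\Gamma)\rho^2\mu^2}{4\Gamma}.$$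
   Context: $\|\cdot\|$ is the Euclidean norm. For $\rho\in(0,1]$, $\mu>0$, a differentiable $f$ with minimizer $\bm{w}^\star$ is $(\rho,\mu)$-strongly quasar-convex with respect to $\bm{w}^\star$ if $f(\bm{w}^\star)\ge f(\bm{w})+\frac1\rho\langle\nabla f(\bm{w}),\bm{w}^\star-\bm{w}\rangle+\frac\mu2\|\bm{w}^\star-\bm{w}\|^2$ for all $\bm{w}\in\mathbb{R}^n$. $f$ is $\Gamma$-weakly smooth if $\|\nabla f(\bm{w})\|^2\le\Gamma(f(\bm{w})-f(\bm{w}^\star))$ for all $\bm{w}\in\mathbb{R}^n$. *)

(* Defs.v *)
From HB Require Import structures.
From mathcomp Require Import all_boot all_order all_algebra.
From mathcomp Require Import all_classical all_reals all_analysis.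
Set Implicit Arguments.
Unset Strict Implicit.
Unset Printing Implicit Defensive.
Import Order.TTheory GRing.Theory Num.Theory.
Import numFieldNormedType.Exports.
Local Open Scope ring_scope.

Definition dotprod (R : realType) (n : nat) (u v : 'rV[R]_n) : R :=
  \sum_(i < n) u 0 i * v 0 i.

(* The canonical norm [`|u|] on ['rV[R]_n] is the sup norm, so the Euclidean
   norm is defined separately. The two norms are equivalent, so [differentiable]
   below has its usual meaning. *)
Definition enorm (R : realType) (n : nat) (u : 'rV[R]_n) : R :=
  Num.sqrt (dotprod u u).

Definition grad (R : realType) (n : nat) (f : 'rV[R]_n -> R) (w : 'rV[R]_n) :
    'rV[R]_n :=
  \row_(i < n) 'D_(delta_mx 0 i) f w.

Definition is_minimizer (R : realType) (n : nat) (f : 'rV[R]_n -> R)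
    (wstar : 'rV[R]_n) : Prop :=
  forall w, f wstar <= f w.

Definition strongly_quasar_convex (R : realType) (n : nat) (rho mu : R)
    (f : 'rV[R]_n -> R) (wstar : 'rV[R]_n) : Prop :=
  forall w, f wstar >= f w + 1 / rho * dotprod (grad f w) (wstar - w)
                       + mu / 2 * enorm (wstar - w) ^+ 2.

Definition weakly_smooth (R : realType) (n : nat) (Gamma : R)
    (f : 'rV[R]_n -> R) (wstar : 'rV[R]_n) : Prop :=
  forall w, enorm (grad f w) ^+ 2 <= Gamma * (f w - f wstar).

(* Main.v *)
Require Import Defs.
From HB Require Import structures.
From mathcomp Require Import all_boot all_order all_algebra.
From mathcomp Require Import all_classical all_reals all_analysis.
From mathcomp Require Import ring lra.
Set Implicit Arguments.
Unset Strict Implicit.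
Unset Printing Implicit Defensive.
Import Order.TTheory GRing.Theory Num.Theory.
Import numFieldNormedType.Exports.
Local Open Scope ring_scope.

(** Put [d = w - w*], [g = grad f w] and [D = f w - f w*]. Quasar-convexity reads
    [<g, d> >= rho (D + mu/2 |d|^2)]. Expanding [|d - alpha g|^2] and using weak
    smoothness bounds it by
    [(1 - alpha rho mu) |d|^2 - (2 alpha rho - alpha^2 Gamma) D],
    where the coefficient of [D] is nonpositive since [alpha < 2 rho / Gamma].
    Quasar-convexity and weak smoothness together also give the quadratic growth
    [D >= rho^2 mu^2 / (4 Gamma) |d|^2], which finishes the proof. *)

Lemma enorm_sqr (R : realType) (n : nat) (u : 'rV[R]_n) :
  enorm u ^+ 2 = dotprod u u.
Proof.
by rewrite sqr_sqrtr //; apply: sumr_ge0 => i _; rewrite -expr2 sqr_ge0.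
Qed.

Lemma dotprodNr (R : realType) (n : nat) (u v : 'rV[R]_n) :
  dotprod u (- v) = - dotprod u v.
Proof.
by rewrite /dotprod -sumrN; apply: eq_bigr => i _; rewrite !mxE mulrN.
Qed.

Lemma enorm_sqrBZ (R : realType) (n : nat) (u v : 'rV[R]_n) (a : R) :
  enorm (u - a *: v) ^+ 2 =
  enorm u ^+ 2 - 2 * a * dotprod v u + a ^+ 2 * enorm v ^+ 2.
Proof.
rewrite !enorm_sqr /dotprod !mulr_sumr -sumrB -big_split /=.
by apply: eq_bigr => i _; rewrite !mxE; ring.
Qed.

Lemma enormN (R : realType) (n : nat) (u : 'rV[R]_n) : enorm (- u) = enorm u.
Proof.
rewrite /enorm; congr Num.sqrt.
by apply: eq_bigr => i _; rewrite !mxE mulrNN.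
Qed.

Lemma quasar_dotprod_ge (R : realType) (n : nat) (rho mu : R)
    (f : 'rV[R]_n -> R) (wstar w : 'rV[R]_n) :
  0 < rho -> strongly_quasar_convex rho mu f wstar ->
  rho * (f w - f wstar + mu / 2 * enorm (w - wstar) ^+ 2)
    <= dotprod (grad f w) (w - wstar).
Proof.
move=> rho_gt0 /(_ w).
rewrite -(opprB w) dotprodNr enormN mulrN div1r => le_f.
by rewrite mulrC -ler_pdivlMr // [_ / rho]mulrC; lra.
Qed.

(** Scaling the lower bound on [<g, d>] by [rho * mu] and splitting the product by AM-GM leaves [rho
    ^+ 2 * mu ^+ 2 / 4 * |d|^2 + rho ^+ 2 * mu * D <= |g|^2], and weak smoothness bounds [|g|^2] by
    [Gamma * D]. Keeping [Gamma] as a factor avoids a sign condition on it. *)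
Lemma quasar_quadratic_growth (R : realType) (n : nat) (rho mu Gamma : R)
    (f : 'rV[R]_n -> R) (wstar w : 'rV[R]_n) :
  is_minimizer f wstar -> 0 < rho -> 0 < mu ->
  weakly_smooth Gamma f wstar -> strongly_quasar_convex rho mu f wstar ->
  rho ^+ 2 * mu ^+ 2 / 4 * enorm (w - wstar) ^+ 2 <= Gamma * (f w - f wstar).
Proof.
move=> /(_ w) min_f rho_gt0 mu_gt0 /(_ w) smooth_f.
move=> /(quasar_dotprod_ge w rho_gt0) quasar_f.
have rm_gt0 : 0 < rho * mu by apply: mulr_gt0.
have D_ge0 : 0 <= rho * mu * (rho * (f w - f wstar)).
  by rewrite !mulr_ge0 ?subr_ge0 // ltW.
have := ler_wpM2l (ltW rm_gt0) quasar_f.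
(* AM-GM: [rho mu <g, d> <= |g|^2 + (rho mu / 2)^2 |d|^2] *)
have := sqr_ge0 (enorm (grad f w - (rho * mu / 2) *: (w - wstar))).
have -> : dotprod (grad f w) (w - wstar) = dotprod (w - wstar) (grad f w).
  by apply: eq_bigr => i _; rewrite mulrC.
rewrite enorm_sqrBZ.
move: smooth_f D_ge0; set g2 := enorm _ ^+ 2; set d2 := enorm _ ^+ 2.
set p := dotprod _ _; lra.
Qed.

Theorem proposition2 (R : realType) (n : nat) (f : 'rV[R]_n -> R)
    (wstar : 'rV[R]_n) (rho mu Gamma : R)
    (f_diff : forall w : 'rV[R]_n, differentiable f w)
    (wstar_min : is_minimizer f wstar)
    (rho_gt0 : 0 < rho) (rho_le1 : rho <= 1) (mu_gt0 : 0 < mu)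
    (f_smooth : weakly_smooth Gamma f wstar)
    (f_quasar : strongly_quasar_convex rho mu f wstar)
    (w : 'rV[R]_n) (alpha : R)
    (alpha_gt0 : 0 < alpha)
    (alpha_lt : alpha <
      Num.min (2 * rho / Gamma)
              ((2 * Gamma + rho ^+ 2 * mu
                - Num.sqrt (4 * Gamma * rho ^+ 2 * mu + rho ^+ 4 * mu ^+ 2))
               / (Gamma * rho * mu))) :
  let wplus := w - alpha *: grad f w in
  let gamma := 1 - alpha * rho * mu
    - (2 * alpha * rho - alpha ^+ 2 * Gamma) * rho ^+ 2 * mu ^+ 2
      / (4 * Gamma) in
  enorm (wplus - wstar) ^+ 2 <= gamma * enorm (w - wstar) ^+ 2.
Proof.
move: alpha_lt; rewrite /= lt_min => /andP[alpha_lt1 _].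
(* The step size range forces this: [2 * rho / Gamma] exceeds [alpha > 0], which also rules out
   [Gamma = 0], where the quotient is [0] by convention. *)
have Gamma_gt0 : 0 < Gamma.
  have : 0 < 2 * rho / Gamma by apply: lt_trans alpha_lt1.
  by rewrite pmulr_rgt0 ?invr_gt0 // mulr_gt0.
have coef_ge0 : 0 <= 2 * alpha * rho - alpha ^+ 2 * Gamma.
  have -> : 2 * alpha * rho - alpha ^+ 2 * Gamma
    = alpha * (2 * rho - alpha * Gamma) by ring.
  by rewrite mulr_ge0 ?subr_ge0 1?ltW // -ltr_pdivlMr.
have growth := quasar_quadratic_growth w wstar_min rho_gt0 mu_gt0
  f_smooth f_quasar.
have quasar := quasar_dotprod_ge w rho_gt0 f_quasar.
have smooth := f_smooth w.
rewrite addrAC enorm_sqrBZ.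
move: growth quasar smooth; set g2 := enorm (grad f w) ^+ 2.
set d2 := enorm _ ^+ 2; set p := dotprod _ _; set D := f w - f wstar.
move=> growth quasar smooth.
have growthV : rho ^+ 2 * mu ^+ 2 / (4 * Gamma) * d2 <= D.
  rewrite -(ler_pM2l Gamma_gt0); apply: le_trans growth.
  by rewrite le_eqVlt; apply/orP; left; apply/eqP; field; rewrite gt_eqF.
(* [lra] treats products as atoms, so each bound is first multiplied by its weight in the expansion
   of [|d - alpha g|^2]: the net coefficient of [D] for growth, [alpha] for [<g, d>] (up to the
   factor 2), [alpha ^+ 2] for [|g|^2]. *)
have := ler_wpM2l coef_ge0 growthV.
have := ler_wpM2l (ltW alpha_gt0) quasar.
have := ler_wpM2l (sqr_ge0 alpha) smooth.
by lra.
Qed.
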